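(* Let $f\colon X\rightarrow Y$ be a continuous surjection of compact metric spaces. Then $f$ is semi-open if and only if the induced map $f_*\colon\mathfrak{M}(X)\rightarrow\mathfrak{M}(Y)$, $\mu\mapsto\mu\circ f^{-1}$, is semi-open.
   Context: For a compact Hausdorff space $Z$, $\mathfrak{M}(Z)$ denotes the set of all regular Borel probability measures on $Z$, equipped with the weak-$*$ topology. A continuous surjection $f\colon X\to Y$ of compact Hausdorff spaces induces a continuous surjection $f_*\colon\mathfrak{M}(X)\to\mathfrak{M}(Y)$, $\mu\mapsto\mu\circ f^{-1}$ (push-forward of measures). A continuous surjection $g\colon A\to B$ of topological spaces is semi-open if for every non-empty open subset $U$ of $A$, the interior of $g[U]$ in $B$ is non-empty. *)

(* Defs.v *)
From HB Require Import structures.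
From mathcomp Require Import all_boot all_order all_algebra.
From mathcomp Require Import all_classical all_reals all_analysis.
From mathcomp Require Import lra.

Set Implicit Arguments.
Unset Strict Implicit.
Unset Printing Implicit Defensive.

Import Order.TTheory GRing.Theory Num.Theory.
Import numFieldTopology.Exports.

Local Open Scope classical_set_scope.
Local Open Scope ring_scope.

(* Measurable types are pointed in the library, hence the spaces here are
   nonempty; the distinguished point plays no other role. *)
#[short(type="pmetricType")]
HB.structure Definition PointedMetric (K : numDomainType) :=
  { M of Pointed M & Metric K M }.

Definition semi_open (A B : topologicalType) (g : A -> B) : Prop :=
  forall U : set A, open U -> U !=set0 -> (g @` U)° !=set0.

Notation borel Z := (g_sigma_algebraType (@open Z)).

(* Every measurable set is both inner regular by compact sets and outer regular
   by open sets. Compact sets are Borel as soon as Z is Hausdorff. *)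
Definition regular_measure (R : realType) (Z : ptopologicalType)
    (mu : set (borel Z) -> \bar R) : Prop :=
  forall B : set (borel Z), measurable B ->
    mu B = ereal_sup [set mu K | K in [set K : set Z | compact K /\ K `<=` B]] /\
    mu B = ereal_inf [set mu U | U in [set U : set Z | open U /\ B `<=` U]].

Section regular_probability.
Variables (R : realType) (Z : ptopologicalType).

Record regular_probability := RegularProbability {
  rprob :> probability (borel Z) R ;
  rprob_regular : regular_measure rprob }.

HB.instance Definition _ := gen_eqMixin regular_probability.
HB.instance Definition _ := gen_choiceMixin regular_probability.

Definition integral_against (mu : regular_probability) :
    {ptws continuousType Z R -> R} :=
  fun g => (\int[mu]_x g x)%R.

(* The weak-* topology: the coarsest one making mu |-> \int[mu]_x g x continuous
   for every continuous g : Z -> R. *)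
HB.instance Definition _ :=
  Topological.copy regular_probability (initial_topology integral_against).

End regular_probability.

Section regularity.
Variables (R : realType) (Z : ptopologicalType).
Hypothesis hZ : hausdorff_space Z.

Lemma compact_borel (K : set Z) :
  compact K -> measurable (K : set (borel Z)).
Proof.
move=> cK; rewrite -[K]setCK; apply: measurableC.
apply: sub_sigma_algebra; apply: closed_openC; exact: compact_closed.
Qed.

Lemma open_borel (U : set Z) :
  open U -> measurable (U : set (borel Z)).
Proof. by move=> oU; exact: sub_sigma_algebra. Qed.

Lemma inner_regularW (nu : probability (borel Z) R) :
  (forall B : set (borel Z), measurable B ->
    (nu B <= ereal_sup
      [set nu K | K in [set K : set Z | compact K /\ K `<=` B]])%E) ->
  regular_measure nu.
Proof.
move=> inner B mB; split.
  apply/eqP; rewrite eq_le inner//=; apply: ge_ereal_sup => _ [K [cK KB] <-].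
  by apply: le_measure => //; rewrite inE//; exact: compact_borel.
apply/eqP; rewrite eq_le; apply/andP; split.
  apply: le_ereal_inf_tmp => _ [U [oU BU] <-].
  by apply: le_measure => //; rewrite inE//; exact: open_borel.
have mC := measurableC mB.
have nuB : nu B = (1 - nu (~` B))%E by rewrite -probability_setC// setCK.
apply/lee_addgt0Pr => e e0.
have := inner _ mC.
set S := ereal_sup _ => leS.
have Sfin : S \is a fin_num.
  rewrite fin_numE; apply/andP; split.
    by rewrite -ltNye (lt_le_trans _ leS)// (lt_le_trans ltNy0)// measure_ge0.
  rewrite -ltey; apply: (@le_lt_trans _ _ 1%E); last exact: ltry.
  apply: ge_ereal_sup => _ [K [cK KB] <-].
  by apply: probability_le1; exact: compact_borel.
have [_ [K [cK KB] <-] SK] := ub_ereal_sup_adherent e0 Sfin.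
have mK := compact_borel cK.
apply: (@le_trans _ _ (nu (~` K))).
  apply: ereal_inf_lbound; exists (~` K) => //; split.
    by apply: closed_openC; exact: compact_closed.
  by move=> z Bz Kz; exact: (KB z Kz).
rewrite nuB probability_setC//.
have : (nu (~` B) - e%:E < nu K)%E by rewrite (le_lt_trans _ SK)// leeB.
rewrite -(fineK (fin_num_measure nu _ mC)) -(fineK (fin_num_measure nu _ mK)).
rewrite -!EFinD lte_fin lee_fin; lra.
Qed.

End regularity.

Section borel_fun.
Variables (X Y : ptopologicalType) (f : X -> Y) (cf : continuous f).

(* f between the Borel measurable types; the continuity proof is an argument so
   that measurability can be inferred from the term. *)
Definition borel_fun of continuous f : borel X -> borel Y := f.

Lemma measurable_borel_fun : measurable_fun [set: borel X] (borel_fun cf).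
Proof.
apply: (@measurability _ _ (borel X) (borel Y) _ _ (@open Y)); first by [].
move=> _ [B oB <-]; rewrite setTI; apply: sub_sigma_algebra.
by move/continuousP: cf; apply.
Qed.

HB.instance Definition _ :=
  isMeasurableFun.Build _ _ _ _ (borel_fun cf) measurable_borel_fun.

End borel_fun.

Section pushforward.
Variables (R : realType) (X Y : ptopologicalType).
Hypotheses (hX : hausdorff_space X) (hY : hausdorff_space Y).
Variables (f : X -> Y) (cf : continuous f).

Lemma regular_distribution (mu : regular_probability R X) :
  regular_measure (distribution mu (borel_fun cf)).
Proof.
apply: (@inner_regularW _ _ hY (distribution mu (borel_fun cf))) => // B mB.
have mfB : measurable (borel_fun cf @^-1` B).
  by rewrite -[X in measurable X]setTI; exact: measurable_borel_fun.
rewrite [leLHS](_ : _ = mu (borel_fun cf @^-1` B))//.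
rewrite (rprob_regular mu mfB).1.
apply: ge_ereal_sup => _ [K [cK KB] <-].
have cfK : compact (f @` K).
  by apply: continuous_compact => //; exact: continuous_subspaceT.
apply: (@le_trans _ _ (mu (borel_fun cf @^-1` (f @` K)))).
  apply: le_measure; rewrite ?inE.
  - exact: compact_borel.
  - rewrite -[X in measurable X]setTI.
    by apply: measurable_borel_fun => //; exact: compact_borel.
  - by move=> x Kx; exists x.
apply: ereal_sup_ubound; exists (f @` K) => //; split => //.
by move=> _ [x Kx <-]; exact: KB.
Qed.

Definition pushforward_regular (mu : regular_probability R X) :
    regular_probability R Y :=
  @RegularProbability R Y (distribution mu (borel_fun cf))
    (regular_distribution mu).

End pushforward.

(* Main.v *)
(* Finitely supported measures with support in a prescribed dense set are
   weak-* dense, since continuous functions on a compact space are nearly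
   constant on the pieces of a suitable finite partition.

   If f_* is semi-open and f[U] had empty interior, the open set of measures
   giving a bump function supported in U an integral above 1/2 would be mapped
   to a set containing a measure nu carried by a finite set disjoint from f[U];
   but a lift of nu gives U measure 0.

   If f is semi-open, approximate a measure in the given open set by
   sum_i a_i delta_(x_i) and choose y_i interior to f[K_i], with K_i a small
   closed neighbourhood of x_i. Every nu close to nu0 = sum_i a_i delta_(y_i)
   lifts to a measure close to the original one. The y_i need not be distinct
   (Y may have isolated points), so one Borel section of f does not suffice: a
   random choice function w selects, for each value y among the y_i, an index
   i = w(y) with y_i = y, with probability proportional to a_i; the lift is the
   average over w of the images of nu under Borel sections that send a
   neighbourhood of y into K_(w(y)). *)

Require Import Defs.
From HB Require Import structures.
From mathcomp Require Import all_boot all_order all_algebra.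
From mathcomp Require Import all_classical all_reals all_analysis.
From mathcomp Require Import finmap measurable_realfun lra.

Set Implicit Arguments.
Unset Strict Implicit.
Unset Printing Implicit Defensive.

Import Order.TTheory GRing.Theory Num.Theory.
Import numFieldTopology.Exports numFieldNormedType.Exports.

Local Open Scope classical_set_scope.
Local Open Scope ring_scope.

(** * Integration against probability measures *)

Lemma probability_bounded_integrable d (T : measurableType d) (R : realType)
    (mu : probability T R) (g : T -> R) (M : R) :
  measurable_fun setT g -> (forall x, `|g x| <= M) ->
  mu.-integrable setT (EFin \o g).
Proof.
move=> mg gM; apply: measurable_bounded_integrable => //.
  by rewrite (le_lt_trans (@probability_le1 _ _ _ mu setT measurableT)) ?ltry.
exists M; split; first exact: num_real.
by move=> x Mx y _ /=; rewrite (le_trans (gM y)) // ltW.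
Qed.

Lemma probability_RintegralDr d (T : measurableType d) (R : realType)
    (mu : probability T R) (g : T -> R) (M c : R) :
  measurable_fun setT g -> (forall x, `|g x| <= M) ->
  \int[mu]_x (g x + c) = \int[mu]_x g x + c.
Proof.
move=> mg gM; rewrite RintegralD //; last 2 first.
- exact: probability_bounded_integrable gM.
- exact: finite_measure_integrable_cst.
rewrite Rintegral_cst // [X in fine X](_ : _ = 1%E) ?mulr1 //.
exact: probability_setT.
Qed.

(** The mixture is a finite sum of scaled measures, so its formula holds on every set, measurable or
    not, as comparison by [probability_eq] requires. *)
Lemma exists_mixture d (T : measurableType d) (R : realType) (I : finType)
    (p : I -> R) (m : I -> probability T R) :
  (forall i, 0 <= p i) -> \sum_i p i = 1 ->
  exists mu : probability T R,
    (forall A : set T, mu A = (\sum_i (p i)%:E * m i A)%E) /\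
    (forall (g : T -> R) (M : R), measurable_fun setT g -> (forall x, `|g x| <= M) ->
       \int[mu]_x g x = \sum_i p i * \int[m i]_x g x).
Proof.
move=> p0 p1.
have [i0 _] : exists i0 : I, True.
  apply: contrapT => h; have : \sum_i p i = 0.
    by apply: big1 => i; exfalso; apply: h; exists i.
  by rewrite p1 => /eqP; rewrite oner_eq0.
pose ix n := nth i0 (enum I) n.
have reindex (V : nmodType) (F : I -> V) : \sum_(n < #|I|) F (ix n) = \sum_i F i.
  rewrite -[RHS]big_enum/= [RHS](big_nth i0) big_mkord.
  by rewrite -[in RHS]cardE.
pose mm n : {measure set T -> \bar R} :=
  mscale (NngNum (p0 (ix n))) (m (ix n)).
pose mu0 : {measure set T -> \bar R} := msum mm #|I|.
have mu0E A : mu0 A = (\sum_i (p i)%:E * m i A)%E.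
  by rewrite -(reindex _ (fun i => (p i)%:E * m i A)%E).
have mu01 : mu0 setT = 1%E.
  by rewrite mu0E; under eq_bigr do rewrite probability_setT mule1;
    rewrite sumEFin p1.
pose pb := Measure_isProbability.Build _ _ _ mu0 mu01.
pose mu : probability T R := HB.pack (Measure.sort mu0) pb.
exists mu; split => [A|g M mg gM]; first exact: mu0E.
(* Integration against a sum of measures is computed for nonnegative integrands first; the shift by
   [M] below reduces [g] to this case. *)
have pos (h : T -> R) (N : R) : measurable_fun setT h -> (forall x, 0 <= h x) ->
    (forall x, `|h x| <= N) ->
    \int[mu]_x h x = \sum_i p i * \int[m i]_x h x.
  move=> mh h0 hN; rewrite /Rintegral.
  have -> : (\int[mu]_x (h x)%:E = \int[mu0]_x (h x)%:E)%E by [].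
  have /measurable_EFinP mEh := mh.
  have Eh0 x : setT x -> (0 <= (EFin \o h) x)%E by rewrite lee_fin.
  rewrite (ge0_integral_measure_sum mm measurableT Eh0 mEh).
  have step n : (\int[mm n]_x (h x)%:E =
      (p (ix n) * fine (\int[m (ix n)]_x (h x)%:E))%:E)%E.
    rewrite ge0_integral_mscale //= EFinM fineK //; apply: integrable_fin_num => //.
    exact: (probability_bounded_integrable _ mh hN).
  under eq_bigr do rewrite step.
  rewrite sumEFin /=.
  exact: (reindex _ (fun i => p i * fine (\int[m i]_x (h x)%:E)%E)).
have shift (nu : probability T R) :
    \int[nu]_x (g x + M) = \int[nu]_x g x + M.
  exact (probability_RintegralDr nu M mg gM).
have gM0 x : 0 <= g x + M.
  by have := gM x; rewrite ler_norml => /andP[+ _]; rewrite -subr_ge0 opprK.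
have := pos (fun x => g x + M) (M + M) _ gM0.
rewrite shift; under eq_bigr do rewrite shift mulrDr.
rewrite big_split /= -mulr_suml p1 mul1r => /(_ _ _)/addIr; apply.
- exact: measurable_funD.
- move=> x; rewrite (le_trans (ler_normD _ _)) // lerD // ger0_norm //.
  exact: le_trans (gM x).
Qed.

Lemma Rintegral_lincomb d (T : measurableType d) (R : realType)
    (mu : probability T R) (I : finType) (c : I -> R) (h : I -> T -> R) (M : R) :
  (forall i, measurable_fun setT (h i)) -> (forall i x, `|h i x| <= M) ->
  \int[mu]_x (\sum_i c i * h i x) = \sum_i c i * \int[mu]_x h i x.
Proof.
move=> mh hM; elim: (index_enum I) => [|i s IH].
  under [LHS]eq_Rintegral do rewrite big_nil.
  by rewrite big_nil Rintegral_cst // mul0r.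
under [LHS]eq_Rintegral do rewrite big_cons.
rewrite big_cons -IH RintegralD //.
- by rewrite RintegralZl //; exact: probability_bounded_integrable (hM i).
- apply: (@probability_bounded_integrable _ _ _ _ _ (`|c i| * M)) => [|x].
    exact: measurable_funM.
  by rewrite normrM ler_wpM2l.
- apply: (@probability_bounded_integrable _ _ _ _ _ (\sum_(j <- s) `|c j| * M)).
    by apply: measurable_sum => j; exact: measurable_funM.
  move=> x; rewrite (le_trans (ler_norm_sum _ _ _)) // ler_sum // => j _.
  by rewrite normrM ler_wpM2l.
Qed.

Lemma Rintegral_probability_le d (T : measurableType d) (R : realType)
    (mu : probability T R) (g h : T -> R) (M N c : R) :
  measurable_fun setT g -> (forall x, `|g x| <= M) ->
  measurable_fun setT h -> (forall x, `|h x| <= N) ->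
  (forall x, g x <= h x + c) -> \int[mu]_x g x <= \int[mu]_x h x + c.
Proof.
move=> mg gM mh hN gh; rewrite -(probability_RintegralDr _ _ mh hN).
apply: le_Rintegral => //; first exact: probability_bounded_integrable gM.
apply: (@probability_bounded_integrable _ _ _ _ _ (N + `|c|)) => [|x].
  exact: measurable_funD.
by rewrite (le_trans (ler_normD _ _)) // lerD2r.
Qed.


(** Measures are functions on all sets, so agreement is asked beyond the measurable ones; the other
    fields are proofs, equal by proof irrelevance. *)
Lemma probability_eq d (T : measurableType d) (R : realType)
    (mu nu : probability T R) : (forall A : set T, mu A = nu A) -> mu = nu.
Proof.
case: mu nu => [m [[m1 m2] [m3] [m4] [m5] [m6] [m7] [m8]]].
case=> [n [[n1 n2] [n3] [n4] [n5] [n6] [n7] [n8]]] /= /funext mn.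
move: mn n1 n2 n3 n4 n5 n6 n7 n8 => <- n1 n2.
rewrite -(Prop_irrelevance m1 n1) -(Prop_irrelevance m2 n2).
move=> n3 n4 n5 n6 n7 n8.
rewrite (Prop_irrelevance n3 m3) (Prop_irrelevance n4 m4).
rewrite (Prop_irrelevance n5 m5) (Prop_irrelevance n6 m6).
by rewrite (Prop_irrelevance n7 m7) (Prop_irrelevance n8 m8).
Qed.

Lemma regular_probability_eq (R : realType) (Z : ptopologicalType)
    (mu nu : regular_probability R Z) :
  (forall A : set (borel Z), mu A = nu A) -> mu = nu.
Proof.
case: mu nu => [m rm] [n rn] /= /probability_eq mn.
by move: mn rn => <- rn; rewrite (Prop_irrelevance rm rn).
Qed.

(** * Regularity of Borel probability measures on compact metric spaces *)

Section regularity_of_Borel_probabilities.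
Variables (R : realType) (Z : pmetricType R) (mu : probability (borel Z) R).

(** The sets that satisfy this together with their complement form a sigma-algebra containing the
    open sets. *)
Definition closed_approximable (B : set (borel Z)) :=
  measurable B /\ forall e : R, 0 < e -> exists F : set Z,
    [/\ closed F, F `<=` B & (mu (B `\` F) <= e%:E)%E].

Lemma closed_borel (F : set Z) : closed F -> measurable (F : set (borel Z)).
Proof.
move=> cF; rewrite -[F]setCK; apply: measurableC.
by apply: sub_sigma_algebra; exact: closed_openC.
Qed.

(** Allowing the error [e / 2 ^ n.+1] for [A n] keeps the total below [e]. The last clause serves
    both intersections and unions. *)
Lemma approximable_sequence (A : nat -> set (borel Z)) (e : R) : 0 < e ->
  (forall n, closed_approximable (A n)) ->
  exists F : nat -> set Z, [/\ forall n, closed (F n), forall n, F n `<=` A n &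
    forall B : set (borel Z), measurable B ->
      B `<=` \bigcup_n (A n `\` F n) -> (mu B <= e%:E)%E].
Proof.
move=> e0 hA.
have en n : 0 < e / (2 ^ n.+1)%:R by rewrite divr_gt0 // ltr0n expn_gt0.
have /choice[F HF] : forall n, exists F : set Z, [/\ closed F, F `<=` A n &
    (mu (A n `\` F) <= (e / (2 ^ n.+1)%:R)%:E)%E].
  by move=> n; exact: (hA n).2.
exists F; split=> [n|n|B mB BA]; [by case: (HF n)..|].
apply: (@le_trans _ _ (\sum_(n <oo) mu (A n `\` F n))%E).
  apply: measure_sigma_subadditive => // n; apply: measurableD.
    by case: (hA n).
  by apply: closed_borel; case: (HF n).
apply: le_trans (epsilon_trick0 _ (ltW e0)).
by apply: lee_nneseries => // n _; case: (HF n).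
Qed.

Lemma approximable_bigcap (A : nat -> set (borel Z)) :
  (forall n, closed_approximable (A n)) ->
  closed_approximable (\bigcap_n A n).
Proof.
move=> hA; have mA : measurable (\bigcap_n A n).
  by apply: bigcapT_measurable => n; case: (hA n).
split=> // e e0; have [F [cF FA small]] := approximable_sequence e0 hA.
exists (\bigcap_n F n); split.
- by apply: closed_bigI => n _; exact: cF.
- by apply: subset_bigcap => n _; exact: FA.
- apply: small.
    apply: measurableD => //; apply: closed_borel.
    by apply: closed_bigI => n _; exact: cF.
  move=> x [Ax /existsNP[n /not_implyP[_ nF]]].
  by exists n => //; split => //; exact: Ax.
Qed.

(** The union of the [F n] need not be closed, so it is cut to a finite union. Continuity from above
    controls the cut, for which half of [e] is reserved. *)
Lemma approximable_bigcup (A : nat -> set (borel Z)) :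
  (forall n, closed_approximable (A n)) ->
  closed_approximable (\bigcup_n A n).
Proof.
move=> hA; have mA : measurable (\bigcup_n A n).
  by apply: bigcupT_measurable => n; case: (hA n).
split=> // e e0; have e20 : 0 < e / 2 by rewrite divr_gt0.
have [F [cF FA small]] := approximable_sequence e20 hA.
pose G n : set Z := \big[setU/set0]_(i < n.+1) F i.
have cG n : closed (G n).
  by apply: closed_bigsetU => i _; exact: cF.
have GE : \bigcup_n G n = \bigcup_n F n.
  exact: bigcup_bigsetU_bigcup.
pose D n : set (borel Z) := (\bigcup_n A n) `\` G n.
have mD n : measurable (D n) by apply: measurableD => //; exact: closed_borel.
have DE : \bigcap_n D n = (\bigcup_n A n) `\` \bigcup_n F n.
  rewrite -GE; apply/seteqP; split=> [x Dx|x [Ax nG] n _].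
    split=> [|[n _ Gx]]; first by case: (Dx 0%N).
    by case: (Dx n Logic.I).
  by split=> // Gx; apply: nG; exists n.
have mDi : measurable (\bigcap_n D n) by exact: bigcapT_measurable.
have muDi : (mu (\bigcap_n D n) <= (e / 2)%:E)%E.
  apply: small => //; rewrite DE => x [[n _ Anx] nF].
  by exists n => //; split => // Fn; apply: nF; exists n.
have : mu \o D @ \oo --> mu (\bigcap_n D n).
  apply: nonincreasing_cvg_mu => //.
    by rewrite (le_lt_trans (@probability_le1 _ _ _ mu _ (mD 0%N))) ?ltry.
  move=> m n mn; apply/subsetPset => x [Ax nG]; split => // Gm; apply: nG.
  apply: (@subset_bigsetU _ F m.+1 n.+1 _ x Gm); exact: mn.
have lte : (mu (\bigcap_n D n) < e%:E)%E.
  by rewrite (le_lt_trans muDi) // lte_fin; lra.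
move=> muD; have [n muDn] : exists n, (mu (D n) <= e%:E)%E.
  apply: contrapT => /forallNP h; move: lte; rewrite ltNge => /negP; apply.
  apply: (cvge_ge _ muD); near=> n => /=.
  by move/negP: (h n); rewrite -ltNge => /ltW.
exists (G n); split => // x; rewrite /G -bigcup_mkord => -[i /= _ Fi].
by exists i => //; exact: FA.
Unshelve. all: by end_near. Qed.

Lemma closed_approximableW (F : set Z) : closed F -> closed_approximable F.
Proof.
move=> cF; split=> [|e e0]; first exact: closed_borel.
by exists F; split=> //; rewrite setDv measure0 lee_fin ltW.
Qed.

Lemma open_approximable (U : set Z) : open U -> closed_approximable U.
Proof.
(* [F n] consists of the points at distance at least [1 / (n + 1)] from the complement of [U], so
   [U] is a countable union of closed sets. *)
move=> oU; pose F n := [set x : Z | ball x n.+1%:R^-1 `<=` U].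
have -> : U = \bigcup_n F n.
  apply/seteqP; split => [x Ux|x [n _ Fx]]; last first.
    by apply: Fx; apply: ballxx; rewrite invr_gt0.
  have /nbhs_ballP[r /= r0 rU] : nbhs x U by apply: open_nbhs_nbhs.
  have [n nr] : exists n : nat, n.+1%:R^-1 < r.
    have [n _ /(_ n (leqnn n))] := near_infty_natSinv_lt (PosNum r0).
    by exists n.
  exists n => // y /(le_ball (ltW nr)); exact: rU.
apply: approximable_bigcup => n; apply: closed_approximableW.
rewrite -[F n]setCK; apply: open_closedC; rewrite openE => x /=.
move=> /existsNP[z /not_implyP[xz nUz]].
apply/nbhs_ballP; rewrite ballEmdist /= in xz.
exists (n.+1%:R^-1 - mdist x z); first by rewrite /= subr_gt0.
move=> y; rewrite ballEmdist /= => xy Fy; apply: nUz; apply: Fy.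
rewrite ballEmdist /=; have := metric_triangle y x z.
by rewrite (metric_sym y x); rewrite ltrBrDr in xy; move/le_lt_trans; apply.
Qed.

Lemma compact_metric_regular : compact [set: Z] -> regular_measure mu.
Proof.
move=> cZ.
have approx B : measurable B -> closed_approximable B.
  (* Approximability alone is not visibly stable under complement, so the sigma-algebra induction
     carries [B] and its complement together. *)
  move=> mB; suff [] : closed_approximable B /\ closed_approximable (~` B) by [].
  move: B mB; apply: smallest_sub; last first.
    move=> U oU; split; first exact: open_approximable.
    by apply: closed_approximableW; exact: open_closedC.
  split=> [|B [B1 B2]|B hB].
  - by rewrite setC0; split; apply: closed_approximableW;
      [exact: closed0|exact: closedT].
  - by rewrite setTD setCK.
  - rewrite setC_bigcup; split.
      by apply: approximable_bigcup => n; case: (hB n).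
    by apply: approximable_bigcap => n; case: (hB n).
apply: (inner_regularW (@metric_hausdorff R Z)) => B mB.
apply/lee_addgt0Pr => e e0; have [F [cF FB muF]] := (approx B mB).2 e e0.
have mF := closed_borel cF.
apply: (@le_trans _ _ (mu F + e%:E)%E); last first.
  apply: leeD => //; apply: ereal_sup_ubound; exists F => //; split => //.
  exact: subclosed_compact cZ _.
rewrite -(setDUK FB) (le_trans (measureU2 _ _ _)) //; last by rewrite leeD2l.
exact: measurableD.
Qed.

End regularity_of_Borel_probabilities.

(** * The weak-* topology *)

Lemma continuous_measurable_borel (R : realType) (Z : ptopologicalType)
    (g : Z -> R) :
  continuous g -> measurable_fun [set: borel Z] (g : borel Z -> R).
Proof.
move=> cg; apply: (measurability _ (RGenOpens.measurableE R)).
move=> _ [_ [a [b ->] <-]]; rewrite setTI; apply: sub_sigma_algebra.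
by move/continuousP: cg; apply; exact: interval_open.
Qed.

Lemma compact_continuous_bounded (R : realType) (Z : topologicalType)
    (g : Z -> R) :
  compact [set: Z] -> continuous g -> exists M, forall z, `|g z| <= M.
Proof.
move=> cZ cg; have : compact (g @` [set: Z]).
  by apply: continuous_compact => //; exact: continuous_subspaceT.
move=> /compact_bounded[M [_ /(_ (M + 1))]]; rewrite ltrDl ltr01 => /(_ isT) h.
by exists (M + 1) => z; apply: h; exists z.
Qed.

Lemma integral_continuous (R : realType) (Z : ptopologicalType)
    (g : continuousType Z R) :
  continuous (fun mu : regular_probability R Z => \int[mu]_x g x).
Proof.
move=> mu; apply: (@continuous_comp _ _ _ (@integral_against R Z)
  (fun h : {ptws continuousType Z R -> R} => h g)).
  exact: initial_continuous.
exact: (@proj_continuous (continuousType Z R) (fun=> R) g).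
Qed.

Lemma nbhs_weak (R : realType) (Z : ptopologicalType)
    (mu : regular_probability R Z) (U : set (regular_probability R Z)) :
  nbhs mu U -> exists (gs : seq (continuousType Z R)) (e : R), 0 < e /\
    forall nu : regular_probability R Z,
      (forall g, g \in gs -> `|\int[mu]_x g x - \int[nu]_x g x| < e) -> U nu.
Proof.
(* The sets of the conclusion form a filter that converges to [mu]. *)
pose F : set_system (regular_probability R Z) := fun U =>
  exists (gs : seq (continuousType Z R)) (e : R), 0 < e /\
    forall nu : regular_probability R Z,
      (forall g, g \in gs -> `|\int[mu]_x g x - \int[nu]_x g x| < e) -> U nu.
have FF : Filter F.
  split; first by exists [::], 1; split.
  - move=> A B [gs [e [e0 hA]]] [hs [d [d0 hB]]].
    exists (gs ++ hs), (Num.min e d); split=> [|nu h]; first by rewrite lt_min e0.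
    split; [apply: hA|apply: hB] => g gin;
      have := h g; rewrite mem_cat gin ?orbT => /(_ isT);
      by rewrite lt_min => /andP[].
  - move=> A B AB [gs [e [e0 hA]]]; exists gs, e; split=> // nu /hA; exact: AB.
suff FU : @integral_against R Z nu @[nu --> F] --> integral_against mu.
  move=> [V [[B oB <-] Bmu OU]].
  exact: (filterS OU (FU _ (open_nbhs_nbhs (conj oB Bmu)))).
apply/cvg_sup => g V [W [[B oB <-] Bmu OV]]; apply: (filterS OV).
have /nbhs_ballP[e /= e0 eB] : nbhs (\int[mu]_x g x) B.
  exact: open_nbhs_nbhs.
exists [:: g], e; split => // nu; rewrite /= => /(_ g); rewrite inE eqxx.
by move=> /(_ isT) h; apply: eB.
Qed.

Lemma near_seq (T : Type) (F : set_system T) (FF : Filter F) (I : eqType)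
    (s : seq I) (P : I -> T -> Prop) :
  (forall i, i \in s -> \forall x \near F, P i x) ->
  \forall x \near F, forall i, i \in s -> P i x.
Proof.
elim: s => [|i s IH] h; first exact: nearW.
have hi := h i (mem_head _ _).
have hs : \forall x \near F, forall j, j \in s -> P j x.
  by apply: IH => j js; apply: h; rewrite inE js orbT.
by apply: filterS2 hi hs => x Pi Ps j; rewrite inE => /predU1P[->|/Ps].
Qed.

(** * Finitely supported measures and their density *)

Lemma exists_finitely_supported (R : realType) (Z : pmetricType R)
    (cZ : compact [set: Z]) (I : finType) (x : I -> Z) (a : I -> R) :
  (forall i, 0 <= a i) -> \sum_i a i = 1 ->
  exists nu : regular_probability R Z,
    (forall A : set (borel Z),
       nu A = (\sum_i (a i)%:E * \d_(x i : borel Z) A)%E) /\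
    (forall g : Z -> R, continuous g -> \int[nu]_z g z = \sum_i a i * g (x i)).
Proof.
move=> a0 a1.
have [nu0 [nu0E nu0I]] :=
  exists_mixture (fun i => \d_(x i : borel Z) : probability (borel Z) R) a0 a1.
exists (@RegularProbability R Z nu0 (@compact_metric_regular R Z nu0 cZ)).
split=> // g cg; have [M gM] := compact_continuous_bounded cZ cg.
have mg := continuous_measurable_borel cg.
rewrite [LHS](nu0I g M mg gM); apply: eq_bigr => i _; congr (_ * _).
rewrite /Rintegral integral_dirac //; last exact/measurable_EFinP.
by rewrite diracT mul1e.
Qed.

Lemma finite_convex_approximation (R : realType) (Z : pmetricType R)
    (cZ : compact [set: Z]) (D : set Z) (mu : regular_probability R Z)
    (U : set (regular_probability R Z)) :
  dense D -> nbhs mu U ->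
  exists (n : nat) (x : 'I_n -> Z) (a : 'I_n -> R)
      (nu : regular_probability R Z),
    [/\ U nu, forall i, D (x i), forall i, 0 <= a i, \sum_i a i = 1 &
      (forall A : set (borel Z),
         nu A = (\sum_i (a i)%:E * \d_(x i : borel Z) A)%E) /\
      (forall g : Z -> R, continuous g ->
        \int[nu]_z g z = \sum_i a i * g (x i))].
Proof.
move=> dD /nbhs_weak[gs [e [e0 gsU]]].
have e40 : 0 < e / 4 by rewrite divr_gt0.
pose V z : set Z := [set z' | forall g : continuousType Z R, g \in gs ->
  `|g z - g z'| < e / 4].
have nV z : nbhs z (V z).
  apply: near_seq => g _; have := @cts_fun _ _ g z.
  by move=> /cvgr_dist_lt; apply.
have := cZ; rewrite compact_cover => /(_ Z setT (fun z => (V z)°)).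
case=> [z _|z _|s _ sV]; first exact: open_interior.
  by exists z => //; exact: nV.
pose r : seq Z := enum_fset s; pose n := size r.
have /choice[d0 hd] : forall z, exists y, ((V z)° `&` D) y.
  by move=> z; apply: dD; [exists z; exact: nV|exact: open_interior].
(* Disjointifying the finite subcover gives a Borel partition. For [k] beyond [n], [W k] uses the
   default [point]; [inB] shows that the first [n] pieces already cover. *)
pose W k : set (borel Z) := (V (nth point r k))°.
pose B (i : 'I_n) : set (borel Z) := seqDU W i.
have mW k : measurable (W k) by apply: sub_sigma_algebra; exact: open_interior.
have mB i : measurable (B i).
  by apply: measurableD => //; exact: bigsetU_measurable.
have inB z : exists k, B k z.
  have [w ws Vw] := sV z Logic.I.
  have : (\bigcup_k W k) z.
    by exists (index w r) => //; rewrite /W nth_index.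
  rewrite seqDU_bigcup_eq => -[k _ Bk].
  have kn : (k < n)%N.
    rewrite ltnNge; apply/negP => nk.
    case: Bk => _; apply; rewrite -bigcup_mkord; exists (index w r) => /=.
      by rewrite (leq_trans _ nk) // index_mem.
    by rewrite /W nth_index.
  by exists (Ordinal kn).
(* [x i] lies in the cover element that contains [B i], not necessarily in [B i]. Comparing through
   the centre of that element costs twice [e / 4]. *)
pose x (i : 'I_n) := d0 (nth point r i).
have sumB (c : 'I_n -> R) k z : B k z -> \sum_i c i * \1_(B i) z = c k.
  move=> Bkz; rewrite (bigD1 k) //= indicE mem_set // mulr1.
  rewrite big1 ?addr0 // => i ik; rewrite indicE memNset ?mulr0 // => Biz.
  move/eqP: ik; apply; apply/val_inj.
  by apply: (@trivIset_seqDU _ W) => //; exists z.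
pose a i := \int[mu]_z (\1_(B i) z : R).
have B1 i z : `|\1_(B i) z : R| <= 1.
  by rewrite indicE; case: (_ \in _); rewrite ?normr1 ?normr0.
have mB1 i : measurable_fun setT (\1_(B i) : borel Z -> R).
  exact: measurable_indic.
have intB (c : 'I_n -> R) :
    \int[mu]_z (\sum_i c i * \1_(B i) z) = \sum_i c i * a i.
  exact: Rintegral_lincomb.
have a0 i : 0 <= a i by apply: Rintegral_ge0 => z _; rewrite indicE.
have a1 : \sum_i a i = 1.
  transitivity (\sum_i 1 * a i); first by apply: eq_bigr => i _; rewrite mul1r.
  rewrite -(intB (fun=> 1)) -[RHS](mulr1 1).
  transitivity (\int[mu]_z (cst 1 z : R)).
    by apply: eq_Rintegral => z _; have [k Bk] := inB z; rewrite (sumB _ _ _ Bk).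
  rewrite Rintegral_cst // [X in fine X](_ : _ = 1%E) //.
  exact: probability_setT.
have [nu [nuE nuI]] := exists_finitely_supported cZ x a0 a1.
exists n, x, a, nu; split => //; last by move=> i; case: (hd (nth point r i)).
apply: gsU => g gin; have cg := @cts_fun _ _ g.
have [M gM] := compact_continuous_bounded cZ cg.
have mg := continuous_measurable_borel cg.
rewrite nuI //; under eq_bigr do rewrite mulrC; rewrite -intB.
have close z : `|g z - \sum_i g (x i) * \1_(B i) z| <= e / 2.
  have [k Bk] := inB z; rewrite (sumB _ _ _ Bk).
  have Vz : V (nth point r k) z by apply: interior_subset; case: Bk.
  have Vx : V (nth point r k) (x k).
    by apply: interior_subset; case: (hd (nth point r k)).
  have := ltW (Vz _ gin); have := ltW (Vx _ gin).
  rewrite !ler_norml => /andP[? ?] /andP[? ?]; apply/andP; split; lra.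
pose H z := \sum_i g (x i) * \1_(B i) z.
have HM z : `|H z| <= M.
  by have [k Bk] := inB z; rewrite /H (sumB _ _ _ Bk).
have mH : measurable_fun setT (H : borel Z -> R).
  by apply: measurable_sum => i; exact: measurable_funM.
have le1 : \int[mu]_z g z <= \int[mu]_z H z + e / 2.
  apply: Rintegral_probability_le mg gM mH HM _ => z.
  by have := close z; rewrite ler_norml -/(H z) => /andP[? ?]; lra.
have le2 : \int[mu]_z H z <= \int[mu]_z g z + e / 2.
  apply: Rintegral_probability_le mH HM mg gM _ => z.
  by have := close z; rewrite ler_norml -/(H z) => /andP[? ?]; lra.
rewrite -[X in `|_ - X|]/(\int[mu]_z H z) ltr_norml; apply/andP; split; lra.
Qed.

(** * Borel sections *)

Lemma compact_nested_nonempty (T : topologicalType) (K : nat -> set T) :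
  compact [set: T] -> (forall n, closed (K n)) -> (forall n, K n !=set0) ->
  (forall n, K n.+1 `<=` K n) -> exists p, forall n, K n p.
Proof.
move=> cT cK K0 KS.
have Kle m n : (m <= n)%N -> K n `<=` K m.
  elim: n => [|n IH]; first by rewrite leqn0 => /eqP->.
  rewrite leq_eqVlt => /predU1P[->//|/IH]; exact: subset_trans.
pose F : set_system T := fun A => exists n, K n `<=` A.
have FF : ProperFilter F.
  split; first by case=> n; rewrite subset0; apply/eqP/set0P.
  split; first by exists 0%N.
  - move=> A B [m mA] [n nB]; exists (maxn m n) => x Kx.
    by split; [exact/mA/(Kle _ _ (leq_maxl m n))|
               exact/nB/(Kle _ _ (leq_maxr m n))].
  - by move=> A B AB [n nA]; exists n; exact: subset_trans AB.
have [p [_ clp]] := cT F FF filterT.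
exists p => n; rewrite ((closure_id (K n)).1 (cK n)) => A nA.
by apply: clp => //; exists n.
Qed.

Lemma second_countable_sequence (T : ptopologicalType) :
  @second_countable T -> exists B : nat -> set T,
    (forall n, open (B n)) /\
    forall x A, nbhs x A -> exists n, B n x /\ B n `<=` A.
Proof.
move=> [B cB [oB bB]].
have B0 : B !=set0.
  by have [U [BU _] _] := bB point setT filterT; exists U.
have /pfcard_geP[B00|/unsquash e] := cB; first by move: B0; rewrite B00 => -[].
exists e; split => [n|x A /bB[U [BU Ux] UA]]; first exact/oB/funS.
by have [n _ en] := 'surj_e BU; exists n; rewrite en.
Qed.

Section Borel_section.
Variables (X Y : ptopologicalType) (f : X -> Y) (P : nat -> set X).
Hypotheses (cX : compact [set: X]) (hY : hausdorff_space Y).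
Hypotheses (cf : continuous f) (sf : set_surj [set: X] [set: Y] f).
Hypothesis cP : forall n, closed (P n).
Hypothesis sepP : forall p q, p <> q -> exists n, P n p /\ ~ P n q.

(* Greedy narrowing of the fiber of [y]: intersect it with each [P m] in turn,
   whenever something is left. In the limit a single point remains. *)
Fixpoint narrowed_fiber (n : nat) (y : Y) : set X :=
  if n is m.+1 then
    [set x | narrowed_fiber m y x /\
             (narrowed_fiber m y `&` P m !=set0 -> P m x)]
  else f @^-1` [set y].

Let narrowed_fiberS n y : narrowed_fiber n.+1 y =
  if `[< narrowed_fiber n y `&` P n !=set0 >] then narrowed_fiber n y `&` P n
  else narrowed_fiber n y.
Proof.
case: asboolP => h; apply/seteqP; split => x /=; first by case=> ? /(_ h).
- by case.
- by case.
- by [].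
Qed.

Let closed_narrowed_fiber n y : closed (narrowed_fiber n y).
Proof.
elim: n => [|n IH]; last first.
  by rewrite (narrowed_fiberS n y); case: asboolP => // _; exact: closedI.
apply: closed_comp => [x _|]; first exact: cf.
exact/accessible_closed_set1/hausdorff_accessible.
Qed.

Let narrowed_fiber_nonempty n y : narrowed_fiber n y !=set0.
Proof.
elim: n => [|n IH]; first by have [x _ <-] := sf (I : [set: Y] y); exists x.
by rewrite (narrowed_fiberS n y); case: asboolP.
Qed.

(* Quantifying over all closed [F] is what makes the induction on [n] work. *)
Let narrowed_fiber_hits_measurable n (F : set X) : closed F ->
  measurable ([set y | narrowed_fiber n y `&` F !=set0] : set (borel Y)).
Proof.
elim: n F => [|n IH] F cF.
  rewrite (_ : mkset _ = f @` F); last first.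
    by apply/seteqP; split => [y [x [<- Fx]]|_ [x Fx <-]]; exists x.
  apply: compact_borel => //; apply: continuous_compact.
    exact: continuous_subspaceT.
  exact: subclosed_compact cX _.
rewrite (_ : mkset _ =
    [set y | narrowed_fiber n y `&` P n !=set0] `&`
    [set y | narrowed_fiber n y `&` (P n `&` F) !=set0] `|`
    ~` [set y | narrowed_fiber n y `&` P n !=set0] `&`
    [set y | narrowed_fiber n y `&` F !=set0]).
  apply: measurableU; apply: measurableI; rewrite ?setTI.
  - by apply: IH; exact: cP.
  - by apply: IH; exact: closedI.
  - by apply: measurableC; apply: IH; exact: cP.
  - exact: IH.
apply/seteqP; split => y; rewrite /mkset (narrowed_fiberS n y); case: asboolP => h.
- by rewrite -setIA => ?; left.
- by move=> ?; right.
- by rewrite -setIA => -[[]|[]].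
- by move=> [[]|[]].
Qed.

(** The one point left by the narrowing defines [s], and [P 0] comes first, so [s] enters it
    whenever the fiber meets it. By compactness [s y] lies in a closed [F] iff every narrowed fiber
    of [y] meets [F]; hence preimages of closed sets are countable intersections of Borel sets. *)
Lemma exists_Borel_section : exists s : Y -> X, [/\ forall y, f (s y) = y,
  forall y, (f @` P 0%N) y -> P 0%N (s y) &
  measurable_fun [set: borel Y] (s : borel Y -> borel X)].
Proof.
have /choice[s Ks] : forall y, exists x, forall n, narrowed_fiber n y x.
  by move=> y; apply: compact_nested_nonempty => // n x [].
(* If [q] differed from [s y], some [P n] would contain [s y] but not [q], and stage [n.+1] would
   have removed [q]. *)
have s_unique y q : (forall n, narrowed_fiber n y q) -> q = s y.
  move=> Kq; apply: contrapT => /nesym/sepP[n [Pn]]; apply.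
  case: (Kq n.+1) => _; apply; exists (s y); split => //; exact: Ks.
have s_hits (F : set X) y : closed F ->
    F (s y) <-> forall n, narrowed_fiber n y `&` F !=set0.
  move=> cF; split=> [Fs n|h]; first by exists (s y).
  have [|||p Kp] :=
      compact_nested_nonempty (K := fun n => narrowed_fiber n y `&` F) cX.
  - by move=> n; exact: closedI.
  - exact: h.
  - by move=> n x [[]].
  - by rewrite -(s_unique y p) => [|n]; [case: (Kp 0%N)|case: (Kp n)].
exists s; split=> [y|y [x Px fx]|]; first exact: (Ks y 0%N).
  by case: (Ks y 1%N) => _; apply; exists x.
apply: (@measurability _ _ (borel Y) (borel X) _ _ (@open X)); first by [].
move=> _ [U oU <-]; rewrite setTI -[_ @^-1` _]setCK; apply: measurableC.
rewrite (_ : ~` _ =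
    \bigcap_n [set y | narrowed_fiber n y `&` ~` U !=set0]); last first.
  apply/seteqP; split => y h; last first.
    by apply/(s_hits _ _ (open_closedC oU)) => n; exact: h.
  by move=> n _; apply: (s_hits _ _ (open_closedC oU)).1.
apply: bigcapT_measurable => n; apply: narrowed_fiber_hits_measurable.
exact: open_closedC.
Qed.

End Borel_section.

Lemma exists_Borel_section_through (R : realType) (X : pmetricType R)
    (Y : ptopologicalType) (f : X -> Y) (C : set X) :
  compact [set: X] -> hausdorff_space Y -> continuous f ->
  set_surj [set: X] [set: Y] f -> closed C ->
  exists s : Y -> X, [/\ forall y, f (s y) = y,
    forall y, (f @` C) y -> C (s y) &
    measurable_fun [set: borel Y] (s : borel Y -> borel X)].
Proof.
move=> cX hY cf sf cC.
have [B [oB bB]] := second_countable_sequence (compact_second_countable cX).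
(* [C] takes the first place; the complements of the basic open sets separate points. *)
pose P n := if n is m.+1 then ~` B m else C.
apply: (@exists_Borel_section X Y f P) => // [[|n]//=|p q pq].
  exact: open_closedC.
have [n [Bq Bp]] : exists n, B n q /\ B n `<=` ~` [set p].
  apply: bB; apply: open_nbhs_nbhs; split; last by move/esym.
  apply: closed_openC; apply/accessible_closed_set1/hausdorff_accessible.
  exact: metric_hausdorff.
by exists n.+1; split => [/Bp|]; apply.
Qed.

(** * Bump functions *)

Section bump.
Variables (R : realType) (Z : pmetricType R).

Lemma mdist_continuous (z0 : Z) : continuous (mdist z0 : Z -> R).
Proof.
move=> z; apply/cvgrPdist_lt => e e0; near=> w.
have : ball z e w by near: w; exact: nbhsx_ballx.
rewrite ballEmdist /= => zw.
have := metric_triangle z0 z w; have := metric_triangle z0 w z.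
rewrite (metric_sym w z) ltr_norml => ? ?; apply/andP; split; lra.
Unshelve. all: by end_near. Qed.

Definition bump (z0 : Z) (r : R) (z : Z) : R :=
  Num.max 0 (1 - mdist z0 z / r).

Lemma bump_continuous z0 r : continuous (bump z0 r).
Proof.
move=> z; apply: (@continuous_max R Z (cst 0) (fun z => 1 - mdist z0 z / r)).
  exact: cst_continuous.
apply: cvgB; first exact: cvg_cst.
by apply: cvgM; [exact: mdist_continuous|exact: cvg_cst].
Qed.

Lemma bump_ge0 z0 r z : 0 <= bump z0 r z.
Proof. by rewrite le_max lexx. Qed.

Lemma bump_le1 z0 r z : 0 < r -> bump z0 r z <= 1.
Proof.
by move=> r0; rewrite ge_max ler01 gerBl divr_ge0 ?mdist_ge0 // ltW.
Qed.

Lemma bump_center z0 r : bump z0 r z0 = 1.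
Proof. by rewrite /bump mdistxx mul0r subr0 max_r. Qed.

Lemma bump_support z0 r z : 0 < r -> bump z0 r z != 0 -> mdist z0 z < r.
Proof.
move=> r0; apply: contraNT; rewrite -leNgt => rz.
by rewrite /bump max_l // subr_le0 ler_pdivlMr // mul1r.
Qed.

End bump.

Lemma separated_bumps (R : realType) (Z : pmetricType R) (J : finType)
    (z : J -> Z) (N : J -> set Z) :
  injective z -> (forall j, nbhs (z j) (N j)) ->
  exists (psi : J -> Z -> R) (E : J -> set Z),
  [/\ forall j, continuous (psi j), forall j y, 0 <= psi j y <= 1,
      forall j k, psi j (z k) = (j == k)%:R &
      [/\ forall j y, psi j y != 0 -> E j y, forall j, closed (E j),
          forall j, E j `<=` N j &
          forall j k y, E j y -> E k y -> j = k]].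
Proof.
move=> zI nN.
(* Each ball stays within half the distance to any other centre, so the balls are disjoint by the
   triangle inequality. *)
have /choice[r hr] : forall j, exists r : R, 0 < r /\ ball (z j) r `<=`
    [set y | N j y /\
      forall k, k \in enum J -> j != k -> mdist (z j) y < mdist (z j) (z k) / 2].
  move=> j; suff /nbhs_ballP[r /= r0 h] : nbhs (z j) [set y | N j y /\
      forall k, k \in enum J -> j != k -> mdist (z j) y < mdist (z j) (z k) / 2].
    by exists r.
  apply: filterI => //; apply: near_seq => k _.
  have [->|jk] := eqVneq j k; first by near=> y.
  have d0 : 0 < mdist (z j) (z k) / 2.
    by rewrite divr_gt0 // mdist_gt0; apply: contraNneq jk => /zI ->.
  near=> y => _; have : ball (z j) (mdist (z j) (z k) / 2) y.
    by near: y; exact: nbhsx_ballx.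
  by rewrite ballEmdist.
(* Half the radius puts this closed ball inside the open ball of radius [r j], hence inside
   [N j]. *)
pose E j := [set y | mdist (z j) y <= r j / 2].
have r20 j : 0 < r j / 2 by rewrite divr_gt0 //; case: (hr j).
have Er j y : E j y -> ball (z j) (r j) y.
  rewrite /E ballEmdist /= => h; have := r20 j; lra.
have Einj j k y : E j y -> E k y -> j = k.
  move=> /Er/(hr j).2[_ /(_ k)] hj /Er/(hr k).2[_ /(_ j)] hk.
  apply/eqP; apply: contraT => jk.
  have := hj _ jk; rewrite mem_enum => /(_ isT).
  have := hk; rewrite mem_enum eq_sym => /(_ isT jk).
  have := metric_triangle (z j) y (z k).
  rewrite (metric_sym y (z k)) (metric_sym (z k) (z j)); lra.
have psiE j y : bump (z j) (r j / 2) y != 0 -> E j y.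
  by move=> /(bump_support (r20 j)); rewrite /E /= => /ltW.
exists (fun j => bump (z j) (r j / 2)), E; split.
- by move=> j; exact: bump_continuous.
- by move=> j y; rewrite bump_ge0 bump_le1.
- move=> j k; have [->|jk] := eqVneq j k; first exact: bump_center.
  apply/eqP; apply: contraT => /psiE Ejk; move/eqP: jk; case.
  apply: Einj Ejk _; apply: psiE; rewrite bump_center; exact: oner_neq0.
split => //.
- move=> j; rewrite (_ : E j = mdist (z j) @^-1` [set x | x <= r j / 2]) //.
  by apply: closed_comp (@closed_le _ _) => x _; exact: mdist_continuous.
- by move=> j y /Er/(hr j).2[].
Unshelve. all: by end_near. Qed.

(** * Random choice functions *)

(** [q j] is the law of [i] conditioned on [gam i = j]. The last clause avoids division, so it
    survives classes of weight zero, where every [a i] vanishes. *)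
Lemma exists_conditional_law (R : realFieldType) (I J : finType) (gam : I -> J)
    (a : I -> R) :
  (forall j, exists i, gam i = j) -> (forall i, 0 <= a i) ->
  exists q : J -> I -> R,
  [/\ forall j i, 0 <= q j i, forall j, \sum_i q j i = 1,
      forall j i, q j i != 0 -> gam i = j &
      forall j i, (\sum_(k | gam k == j) a k) * q j i = (gam i == j)%:R * a i].
Proof.
move=> /choice[i0 hi0] a0.
pose b j := \sum_(k | gam k == j) a k.
have b0 j : 0 <= b j by apply: sumr_ge0.
(* In a class of weight zero the point mass at [i0 j] is used, which still lives on the class. *)
pose q j i := if b j == 0 then (i == i0 j)%:R else (gam i == j)%:R * (a i / b j).
exists q; split => [j i|j|j i|j i]; rewrite /q -?/(b j).
- by case: eqP => _; [exact: ler0n|rewrite mulr_ge0 ?divr_ge0 ?ler0n].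
- have [bj|bj] := eqVneq (b j) 0.
    by rewrite (bigD1 (i0 j)) //= eqxx big1 ?addr0 // => i /negbTE ->.
  transitivity ((\sum_(k | gam k == j) a k) / b j); last exact: divff.
  rewrite mulr_suml [RHS]big_mkcond /=; apply: eq_bigr => i _.
  by case: (gam i == j); rewrite ?mul1r ?mul0r.
- case: (b j =P 0) => _.
    by case: (i =P i0 j) => [-> _|_]; [exact: hi0|rewrite eqxx].
  by case: (gam i =P j) => // _; rewrite mul0r eqxx.
- have [bj|bj] := eqVneq (b j) 0; last first.
    by rewrite mulrCA [X in _ * X]mulrC divfK.
  rewrite bj mul0r; have [gi|] := eqVneq (gam i) j; last by rewrite mul0r.
  rewrite mul1r; apply/esym/eqP; rewrite eq_le a0 andbT -bj /b.
  by rewrite (bigD1 i) ?gi //= lerDl sumr_ge0.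
Qed.

(** The coordinates [w j] are drawn independently with laws [q j]; the last clause identifies the
    marginal at [j]. *)
Lemma exists_random_choice (R : realFieldType) (I J : finType)
    (q : J -> I -> R) :
  (forall j i, 0 <= q j i) -> (forall j, \sum_i q j i = 1) ->
  exists p : {ffun J -> I} -> R,
  [/\ forall w, 0 <= p w, \sum_w p w = 1,
      forall w j, p w != 0 -> q j (w j) != 0 &
      forall j (phi : I -> R), \sum_w p w * phi (w j) = \sum_i q j i * phi i].
Proof.
move=> q0 q1; exists (fun w => \prod_j q j (w j)); split.
- by move=> w; exact: prodr_ge0.
- by rewrite -bigA_distr_bigA big1.
- by move=> w j /prodf_neq0 -> .
- move=> j phi.
  (* Weighting only the factor [j] by [phi] keeps a product of sums, which expands over all choice
     functions. *)
  transitivity (\prod_k \sum_i (if k == j then q k i * phi i else q k i)).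
    rewrite bigA_distr_bigA; apply: eq_bigr => w _.
    rewrite (bigD1 j) //= [RHS](bigD1 j) //= eqxx mulrAC; congr (_ * _).
    by apply: eq_bigr => k /negbTE ->.
  rewrite (bigD1 j) //= eqxx [X in _ * X]big1 ?mulr1 // => k /negbTE kj.
  by under eq_bigr do rewrite kj.
Qed.

(** * Semi-openness *)

Section semi_open_pushforward.
Variables (R : realType) (X Y : pmetricType R).
Hypotheses (cX : compact [set: X]) (cY : compact [set: Y]).
Variables (f : X -> Y) (cf : continuous f).

Let push := pushforward_regular (R := R) (@metric_hausdorff R X)
               (@metric_hausdorff R Y) cf.

Lemma semi_open_of_pushforward : semi_open push -> semi_open f.
Proof.
move=> so U oU [x0 Ux0].
have /nbhs_ballP[r /= r0 rU] : nbhs x0 U by exact: open_nbhs_nbhs.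
pose phi : continuousType X R := mkcts (@bump_continuous R X x0 r).
pose UU := [set mu : regular_probability R X | 1 / 2 < \int[mu]_x phi x].
have oUU : open UU.
  have /continuousP := @integral_continuous R X phi.
  by move=> /(_ [set t | 1 / 2 < t]); apply; exact: open_gt.
have [nu nuU] : (push @` UU)° !=set0.
  apply: so => //.
  (* The point mass at [x0] belongs to [UU], as the bump equals 1 at its centre. *)
  have [mu [_ mui]] := @exists_finitely_supported R X cX 'I_1 (fun=> x0)
    (fun=> 1) (fun=> ler01) (big_ord1 _ _).
  exists mu; rewrite /UU /= mui; last exact: bump_continuous.
  by rewrite big_ord1 mul1r /phi /mkcts /= bump_center; lra.
apply/set0P/eqP => fU0.
have dD : dense (~` (f @` U)).
  move=> B [y By] oB; apply: contrapT => h.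
  suff : (f @` U)° y by rewrite fU0.
  apply: filterS (open_nbhs_nbhs (conj oB By)) => z Bz.
  by apply: contrapT => nz; apply: h; exists z.
have [n [y [a [nu' [nuUU Dy a0 a1 [nuE _]]]]]] :=
  finite_convex_approximation cY dD nuU.
have [mu muU muE] := nuUU.
pose S : set (borel Y) := [set z | exists i, z = y i].
have mS : measurable S.
  apply: compact_borel; first exact: metric_hausdorff.
  rewrite (_ : S = range y); last first.
    by apply/seteqP; split => z [i]; [move=> ->; exists i|move=> _ <-; exists i].
  by apply: finite_compact; apply: finite_image; exact: finite_finset.
have muS : mu (borel_fun cf @^-1` (~` S)) = 0%E.
  rewrite -[LHS]/(push mu (~` S)) muE nuE big1 // => i _.
  by rewrite diracE memNset ?mule0 //; apply; exists i.
have mfS : measurable (borel_fun cf @^-1` (~` S)).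
  rewrite -[X in measurable X]setTI; apply: measurable_borel_fun => //.
  exact: measurableC.
move: muU; rewrite /UU /= => muU.
(* The bump vanishes off [U], and [f] maps [U] outside [S]; so the bump is bounded by the indicator
   of a [mu]-null set. *)
have : \int[mu]_x phi x <=
    \int[mu]_x (\1_(borel_fun cf @^-1` (~` S)) x : R) + 0.
  apply: (@Rintegral_probability_le _ _ _ mu _ _ 1 1).
  - exact: (continuous_measurable_borel (@bump_continuous R X x0 r)).
  - by move=> x; rewrite ger0_norm ?bump_ge0 // bump_le1.
  - exact: measurable_indic.
  - by move=> x; rewrite indicE; case: (_ \in _); rewrite ?normr1 ?normr0.
  move=> x; rewrite addr0 indicE; have [|nS] := boolP (x \in _).
    by rewrite bump_le1.
  rewrite le_eqVlt; apply/orP; left; apply/eqP/eqP; apply: contraNT nS.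
  move=> /(bump_support r0) xr; apply: mem_set => -[i fxi].
  by apply: (Dy i); exists x => //; apply: rU; rewrite ballEmdist.
rewrite addr0 /Rintegral integral_indic // setIT.
have -> : fine (mu (borel_fun cf @^-1` (~` S))) = 0 by rewrite muS.
by move: muU; rewrite /Rintegral; lra.
Qed.

End semi_open_pushforward.

(** * Semi-openness of the push-forward from that of the map *)

Section pushforward_semi_open.
Variables (R : realType) (X Y : pmetricType R).
Hypotheses (cX : compact [set: X]) (cY : compact [set: Y]).
Variables (f : X -> Y) (cf : continuous f).
Hypothesis sf : set_surj [set: X] [set: Y] f.

Let push := pushforward_regular (R := R) (@metric_hausdorff R X)
               (@metric_hausdorff R Y) cf.

(* [nu] is lifted to the mixture of its images under Borel sections [s w],
   where the random choice [w] sends [E j] into [K (w j)]. Equality with [nu]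
   must hold on all subsets, as measures carry junk values on nonmeasurable
   sets; pushing forward along genuine sections of [f] ensures it. *)
Lemma exists_lift (I J : finType) (x : I -> X) (K : I -> set X) (gam : I -> J)
    (q : J -> I -> R) (psi : J -> Y -> R) (E : J -> set Y)
    (nu : regular_probability R Y) :
  (forall i, closed (K i)) ->
  (forall j i, 0 <= q j i) -> (forall j, \sum_i q j i = 1) ->
  (forall j i, q j i != 0 -> gam i = j) ->
  (forall j, continuous (psi j)) -> (forall j y, 0 <= psi j y <= 1) ->
  (forall j y, psi j y != 0 -> E j y) -> (forall j, closed (E j)) ->
  (forall i, E (gam i) `<=` f @` K i) ->
  (forall j k y, E j y -> E k y -> j = k) ->
  exists mu : regular_probability R X, push mu = nu /\
    forall (h : X -> R) (M e : R), continuous h -> (forall z, `|h z| <= M) ->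
      0 <= e -> (forall i z, K i z -> h (x i) <= h z + e) ->
      \sum_j (\sum_i q j i * (h (x i) + M - e)) * \int[nu]_y psi j y <=
      \int[mu]_z h z + M.
Proof.
move=> cK q0 q1 qgam cpsi psi01 psiE cE EK Einj.
have [p [p0 p1 pq pE]] := exists_random_choice q0 q1.
(* Since the [E j] are disjoint, a section that enters [C w] whenever possible sends [E j] into
   [K (w j)], for every [w] of nonzero weight. *)
pose C (w : {ffun J -> I}) : set X :=
  \bigcup_(j in [set` enum J]) (K (w j) `&` f @^-1` E j).
have cC w : closed (C w).
  rewrite /C bigcup_seq; apply: closed_bigsetU => j _; apply: closedI => //.
  by apply: closed_comp => // z _; exact: cf.
have /choice[s hs] : forall w, exists s : Y -> X, [/\ forall y, f (s y) = y,
    forall y, (f @` C w) y -> C w (s y) &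
    measurable_fun [set: borel Y] (s : borel Y -> borel X)].
  by move=> w; apply: exists_Borel_section_through => //; exact: metric_hausdorff.
have ms w : measurable_fun [set: borel Y] (s w : borel Y -> borel X).
  by case: (hs w).
pose sm w : {mfun borel Y >-> borel X} :=
  HB.pack (s w : borel Y -> borel X) (isMeasurableFun.Build _ _ _ _ _ (ms w)).
have [mu0 [mu0E mu0I]] := exists_mixture (fun w => distribution nu (sm w)) p0 p1.
pose mu : regular_probability R X :=
  @RegularProbability R X mu0 (@compact_metric_regular R X mu0 cX).
exists mu; split.
  apply: regular_probability_eq => A.
  transitivity (\sum_w (p w)%:E * nu A)%E; last first.
    by rewrite -ge0_sume_distrl ?sumEFin ?p1 ?mul1e // => w _; rewrite lee_fin.
  rewrite [LHS](mu0E (f @^-1` A)); apply: eq_bigr => w _; congr (_ * _)%E.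
  congr (nu _); apply/seteqP; split => y; rewrite /= /sm /=;
    by case: (hs w) => ->.
move=> h M e ch hM e0 hK.
have mh := continuous_measurable_borel ch.
have mhs w : measurable_fun [set: borel Y] (h \o s w : borel Y -> R).
  exact: (measurableT_comp mh (ms w)).
have hsM w y : `|(h \o s w) y| <= M by exact: hM.
have int w : \int[distribution nu (sm w)]_z h z = \int[nu]_y (h \o s w) y.
  rewrite /Rintegral integral_distribution //; first exact/measurable_EFinP.
  exact: (probability_bounded_integrable _ (mhs w) (hsM w)).
rewrite [X in _ <= X + _](mu0I h M mh hM).
(* A lower bound for [h + M] on [K i]. As [h + M] is nonnegative, the estimate survives
   multiplication by [psi j <= 1] and holds where every [psi j] vanishes. *)
pose c i := h (x i) + M - e.
have bound w : p w != 0 ->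
    \sum_j c (w j) * \int[nu]_y psi j y <= \int[nu]_y (h \o s w) y + M.
  move=> pw.
  have psi1 j y : `|psi j y| <= 1.
    by have /andP[? ?] := psi01 j y; rewrite ger0_norm.
  have mpsi j := continuous_measurable_borel (cpsi j).
  rewrite -(Rintegral_lincomb nu (fun j => c (w j)) mpsi psi1).
  apply: (@Rintegral_probability_le _ _ _ nu _ _ (\sum_j `|c (w j)|) M) => //.
  - by apply: measurable_sum => j; exact: measurable_funM.
  - move=> y; rewrite (le_trans (ler_norm_sum _ _ _)) // ler_sum // => j _.
    by rewrite normrM ler_piMr.
  move=> y; have hM0 : 0 <= h (s w y) + M.
    by have := hM (s w y); rewrite ler_norml => /andP[? _]; lra.
  have [j psij|psi0] := pickP (fun j => psi j y != 0); last first.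
    by rewrite big1 // => j _; have /negbFE/eqP -> := psi0 j; rewrite mulr0.
  have Ej := psiE _ _ psij.
  rewrite (bigD1 j) //= big1 ?addr0 => [|k kj]; last first.
    apply/eqP; rewrite mulf_eq0; apply/orP; right; apply: contraNT kj => psik.
    by apply/eqP/(Einj _ _ y) => //; exact: psiE.
  have gj k : gam (w k) = k by apply: qgam; exact: pq.
  have [z Kz fz] : (f @` K (w j)) y by apply: EK; rewrite gj.
  have [fs hC _] := hs w.
  have [k _ [Kk Ek]] : C w (s w y).
    apply: hC; exists z => //; exists j; first by rewrite /= mem_enum.
    by split => //; rewrite /= fz.
  have kE : k = j by apply: (Einj _ _ y) => //; move: Ek; rewrite /= fs.
  have := hK _ _ Kk; rewrite kE => hx.
  have /andP[? ?] := psi01 j y.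
  apply: (@le_trans _ _ ((h (s w y) + M) * psi j y)); last by rewrite ler_piMr.
  by apply: ler_wpM2r => //; rewrite /c; lra.
(* The marginals of [p] turn the averages over [i] into one average over [w], to which [bound]
   applies. *)
under eq_bigr do rewrite -(pE _ c) mulr_suml.
rewrite exchange_big /=.
apply: (@le_trans _ _ (\sum_w p w * (\int[nu]_y (h \o s w) y + M))).
  apply: ler_sum => w _; under eq_bigr do rewrite -mulrA.
  rewrite -mulr_sumr; have [->|pw] := eqVneq (p w) 0; first by rewrite !mul0r.
  by apply: ler_wpM2l => //; exact: bound.
under [leLHS]eq_bigr do rewrite mulrDr; rewrite big_split /= -mulr_suml p1 mul1r.
by rewrite lerD2r; apply: ler_sum => w _; rewrite int.
Qed.

Lemma pushforward_semi_open : semi_open f -> semi_open push.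
Proof.
move=> so UU oUU [mu0 Umu0].
have dT : dense [set: X] by move=> B B0 _; rewrite setIT.
have [n [x [a [mu1 [Umu1 _ a0 a1 [_ mu1I]]]]]] :=
  finite_convex_approximation cX dT (open_nbhs_nbhs (conj oUU Umu0)).
have [gs [e [e0 gsU]]] := nbhs_weak (open_nbhs_nbhs (conj oUU Umu1)).
(* One quarter of [e] pays for the variation over [K i], another for moving from [nu0] to [nu]; the
   total [e / 2] is below [e]. *)
have e40 : 0 < e / 4 by rewrite divr_gt0.
pose K i : set X := [set z | forall g : continuousType X R, g \in gs ->
  `|g (x i) - g z| <= e / 4].
have cK i : closed (K i).
  rewrite (_ : K i = \bigcap_(g in [set` gs])
      [set z | `|(g : continuousType X R) (x i) - g z| <= e / 4]) //.
  apply: closed_bigI => g _.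
  apply: (@closed_comp _ _ (fun z => `|g (x i) - g z|) [set t | t <= e / 4]).
    move=> z _; apply: cvg_norm; apply: cvgB; first exact: cvg_cst.
    exact: cts_fun.
  exact: closed_le.
have nK i : nbhs (x i) (K i).
  apply: near_seq => g _; have := @cts_fun _ _ g (x i).
  by move=> /cvgr_dist_le; apply.
have /choice[y hy] : forall i, exists y : Y, nbhs y (f @` K i).
  move=> i; have [||y hy] := so (K i)°.
  - exact: open_interior.
  - by exists (x i); exact: nK.
  exists y; apply: filterS hy => _ [z Kz <-]; exists z => //.
  exact: interior_subset.
(* Indices with equal [y i] form one class, so the bumps get distinct centres. *)
pose J := seq_sub (codom y).
pose gam i : J := SeqSub (codom_f y i).
have gam_surj j : exists i, gam i = j.
  by have /codomP[i yi] := ssvalP j; exists i; apply: val_inj.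
(* Intersecting over the whole class makes [E j] liftable into [K i] for whichever [i] of the class
   the random choice picks. *)
pose N (j : J) : set Y := [set y' | forall i, i \in enum 'I_n -> gam i = j ->
  (f @` K i) y'].
have nN j : nbhs (val j) (N j).
  apply: near_seq => i _; have [<-|ij] := pselect (gam i = j).
    by apply: filterS (hy i).
  by near=> y'.
have [psi [E [cpsi psi01 psiz [psiE cE EN Einj]]]] := separated_bumps val_inj nN.
have [q [q0 q1 qgam qa]] := exists_conditional_law gam_surj a0.
have [nu0 [_ nu0I]] := exists_finitely_supported cY y a0 a1.
(* The lower bound of [exists_lift] as a function of [nu]; it involves finitely many integrals of
   continuous functions, hence is weak-* continuous. *)
pose L (h : X -> R) (M : R) (nu : regular_probability R Y) :=
  \sum_j (\sum_i q j i * (h (x i) + M - e / 4)) * \int[nu]_y psi j y.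
have cL h M : continuous (L h M).
  move=> nu; rewrite /L; apply: (@cvg_big R J +%R 0) => [||j _].
  - exact: add_continuous.
  - exact: nbhs_filter.
  - exact: (cvgM (cvg_cst _) (@integral_continuous R Y (mkcts (cpsi j)) nu)).
(* At [nu0] the integral of [psi j] is the weight of the class [j], so by [qa] the conditional laws
   recombine to the weights [a i]. *)
have Lnu0 h M : L h M nu0 = \sum_i a i * h (x i) + M - e / 4.
  have psi_nu0 j : \int[nu0]_y psi j y = \sum_(k | gam k == j) a k.
    rewrite nu0I // [RHS]big_mkcond /=; apply: eq_bigr => i _.
    rewrite (psiz j (gam i)) eq_sym.
    by case: (gam i == j); rewrite ?mulr1 ?mulr0.
  rewrite /L; under eq_bigr do rewrite psi_nu0 mulr_suml.
  rewrite exchange_big /= -addrA -[X in _ + X]mul1r -a1 mulr_suml -big_split /=.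
  apply: eq_bigr => i _; rewrite -mulrDr addrA.
  under eq_bigr do rewrite mulrC mulrA qa -mulrA.
  by rewrite (bigD1 (gam i)) //= eqxx mul1r [X in _ + X]big1 ?addr0 // => j /negbTE;
    rewrite eq_sym => ->; rewrite mul0r.
have /choice[Mg hMg] : forall g : continuousType X R, exists M : R,
    forall z, `|g z| <= M.
  by move=> g; apply: compact_continuous_bounded => //; exact: cts_fun.
exists nu0.
have nearL h M : \forall nu \near nu0, L h M nu0 - e / 4 < L h M nu.
  have lt : L h M nu0 - e / 4 < L h M nu0 by rewrite ltrBlDr ltrDl.
  exact: (cvgr_gt (L h M nu0) (cL h M nu0) _ lt).
(* Lower bounds for both [g] and [- g] control the integral of [g] from two sides. *)
have : \forall nu \near nu0, forall g, g \in gs ->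
    L g (Mg g) nu0 - e / 4 < L g (Mg g) nu /\
    L (fun z => - g z) (Mg g) nu0 - e / 4 < L (fun z => - g z) (Mg g) nu.
  apply: (@near_seq _ _ (nbhs_filter nu0)) => g _.
  by apply: filterI; exact: nearL.
apply: filterS => nu hnu.
have EK i : E (gam i) `<=` f @` K i.
  by move=> y' /EN; apply; rewrite ?mem_enum.
have [mu [munu hmu]] :=
  exists_lift x nu cK q0 q1 qgam cpsi psi01 psiE cE EK Einj.
exists mu => //; apply: gsU => g gin.
have [hg hNg] := hnu g gin.
have cg := @cts_fun _ _ g.
have cNg : continuous (fun z => - g z) by move=> z; apply: cvgN; exact: cg.
have gM := hMg g.
have NgM z : `|- g z| <= Mg g by rewrite normrN.
have mg := continuous_measurable_borel cg.
have K1 i z : K i z -> g (x i) <= g z + e / 4.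
  by move=> /(_ g gin); rewrite ler_norml => /andP[? ?]; lra.
have K2 i z : K i z -> - g (x i) <= - g z + e / 4.
  by move=> /(_ g gin); rewrite ler_norml => /andP[? ?]; lra.
have := hmu _ _ _ cg gM (ltW e40) K1; rewrite -/(L g (Mg g) nu).
have := hmu _ _ _ cNg NgM (ltW e40) K2; rewrite -/(L (fun z => - g z) (Mg g) nu).
have -> : \int[mu]_z (- g z) = - \int[mu]_z g z.
  rewrite -mulN1r -RintegralZl //; last first.
    exact: (probability_bounded_integrable mu mg gM).
  by apply: eq_Rintegral => z _; rewrite mulN1r.
move: hg hNg; rewrite !Lnu0 mu1I //.
have -> : \sum_i a i * - g (x i) = - \sum_i a i * g (x i).
  by rewrite -sumrN; apply: eq_bigr => i _; rewrite mulrN.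
by move=> ? ? ? ?; rewrite ltr_norml; apply/andP; split; lra.
Unshelve. all: by end_near. Qed.

End pushforward_semi_open.

Theorem theoremB (R : realType) (X Y : pmetricType R)
    (cX : compact [set: X]) (cY : compact [set: Y])
    (f : X -> Y) (cf : continuous f) (sf : set_surj [set: X] [set: Y] f) :
  semi_open f <->
  semi_open (pushforward_regular (R := R) (@metric_hausdorff R X)
               (@metric_hausdorff R Y) cf).
Proof.
split; first exact: pushforward_semi_open.
exact: semi_open_of_pushforward.
Qed.
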